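(* For any tree $T$ with $\ell$ leaves and any vertex $x \in V(T)$ we have \[ p_x(T) = \begin{cases} \ell - 1, & \text{if } x \text{ is a leaf,} \\ \ell, & \text{otherwise.} \end{cases} \]
   Context: All graphs are finite, undirected and simple. A leaf is a vertex of degree one. A $u,v$-geodesic is a shortest $u,v$-path. For a vertex $x$ of a graph $G$, a set $S \subseteq V(G)$ is an $x$-position set if for every $y \in S$ no vertex of $S \setminus \{y\}$ lies on any $x,y$-geodesic in $G$. The $x$-position number $p_x(G)$ is the maximum cardinality of an $x$-position set of $G$.
   Formalization: The tree is assumed to have at least two vertices; for the one-vertex tree the printed formula fails, since x is not a leaf and ℓ = 0, yet {x} is an x-position set, so p_x = 1. *)

(* Defs.v *)
(* A graph is an adjacency relation [e] on a finType [V]. *)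
From mathcomp Require Import all_boot.
From mathcomp Require Import boolp.

Set Implicit Arguments.
Unset Strict Implicit.
Unset Printing Implicit Defensive.

Section Graphs.
Variables (V : finType) (e : rel V).
Implicit Types (u v x y z : V) (p q : seq V) (S : {set V}).

Definition simple_graph := symmetric e /\ irreflexive e.

Definition connected_graph := forall u v, connect e u v.

(* [ucycle e c] also holds for [::] and, when e is symmetric, for [:: u; v]
   with u, v adjacent; genuine cycles of a simple graph have length >= 3. *)
Definition acyclic_graph := forall c : seq V, ucycle e c -> size c < 3.

Definition is_tree := [/\ simple_graph, connected_graph & acyclic_graph].

Definition degree v := #|[set w | e v w]|.

Definition leaf v := degree v == 1.

Definition leaves := [set v | leaf v].

(* The path with vertex sequence u :: p, of length size p. *)
Definition uv_path u v p := [/\ path e u p, last u p = v & uniq (u :: p)].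

Definition geodesic u v p :=
  uv_path u v p /\ forall q, uv_path u v q -> size p <= size q.

Definition position_set x S :=
  forall y, y \in S ->
  forall z, z \in S :\ y ->
  forall p, geodesic x y p -> z \notin x :: p.

(* set0 is always an x-position set, so this is the maximum of a nonempty
   family. *)
Definition position_number x :=
  \max_(S : {set V} | `[< position_set x S >]) #|S|.

End Graphs.

(* Main.v *)
(* Order the vertices by z <= y iff z lies on the path from x to y; the
   x-position sets are the antichains.  The leaves other than x are the maximal
   elements, so they form an antichain.  Conversely every vertex lies below such
   a leaf, and the vertices below a given leaf form a chain, so an antichain
   injects into the set of leaves other than x. *)
Require Import Defs.
From mathcomp Require Import all_boot.
From mathcomp Require Import boolp.

Set Implicit Arguments.
Unset Strict Implicit.
Unset Printing Implicit Defensive.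

Section Paths.
Variables (V : finType) (e : rel V).
Implicit Types (u v w x y z : V) (p q : seq V) (S : {set V}).

Lemma uv_path_cat u v p q :
  uv_path e u v (p ++ q) ->
  uv_path e u (last u p) p /\ uv_path e (last u p) v q.
Proof.
rewrite /uv_path cat_path last_cat -cat_cons cat_uniq => -[/andP[ep eq] lq].
case/and3P=> up /hasPn upq uq; split; first by split.
split=> //=; rewrite uq andbT; apply/negP=> /upq.
by rewrite /= mem_last.
Qed.

Lemma connect_uv_path u v : connect e u v -> exists p, uv_path e u v p.
Proof.
by case/connectP=> p ep ->; case/shortenP: ep => q eq uq _; exists q; split.
Qed.

Lemma extend_to_maximal_path x p : path e x p -> uniq (x :: p) ->
  exists q, [/\ path e x (p ++ q), uniq (x :: p ++ q) &
    forall w, e (last x (p ++ q)) w -> w \in x :: p ++ q].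
Proof.
have [n] := ubnP (#|V| - size p); elim: n p => // n IHn p lt_n ep up.
have [/existsP[w /andP[ew w_new]] | /existsPn maxp] :=
  boolP [exists w, e (last x p) w && (w \notin x :: p)]; last first.
  exists [::]; rewrite cats0; split=> // w ew.
  by have := maxp w; rewrite ew /= negbK.
have upw : uniq (x :: rcons p w) by rewrite -rcons_cons rcons_uniq w_new.
have [||| q [eq uq maxq]] := IHn (rcons p w); last first.
- by exists (w :: q); rewrite -cat_rcons.
- exact: upw.
- by rewrite rcons_path ep.
(* The longer path has at most [#|V|] vertices, so the truncated difference [#|V| - size p] is
   positive and strictly decreases. *)
have := max_card (mem (x :: rcons p w)); rewrite (card_uniqP upw) /= size_rcons.
move=> lt_p; rewrite -ltnS (leq_trans _ lt_n) // ltnS subnS prednK //.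
by rewrite subn_gt0 (leq_trans _ lt_p).
Qed.

Hypothesis (sym_e : symmetric e) (acyclic_e : acyclic_graph e).

(** Shortening the walk to a path and closing it up through [u] gives a cycle, which has length at
    least 3 unless the path is trivial. *)
Lemma walk_avoiding_common_neighbor u a b p : e u a -> e u b ->
  path e a p -> last a p = b -> u \notin a :: p -> a = b.
Proof.
move=> eua eub ep lp; case/shortenP: ep lp => q eq uq sub_qp lq unp.
have unq : u \notin a :: q.
  by move: unp; rewrite !inE !negb_or => /andP[-> /=]; apply/contra/sub_qp.
have /acyclic_e : ucycle e (u :: a :: q).
  by rewrite /ucycle cons_uniq unq uq /= eua rcons_path eq lq sym_e eub.
by case: q lq {eq uq sub_qp unq}.
Qed.

Lemma uv_path_inj u v p q : uv_path e u v p -> uv_path e u v q -> p = q.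
Proof.
elim: p u q => [|a p IHp] u [|b q] //.
- by move=> [_ /= <- _] [_ /= lq /andP[+ _]]; rewrite -{1}lq mem_last.
- by move=> [_ /= lp /andP[+ _]] [_ /= def_u _]; rewrite def_u -lp mem_last.
move=> [/= /andP[eua ep] lp /andP[unp up]] [/= /andP[eub eq] lq /andP[unq uq]].
have eq_ab : a = b.
  (* Go from [a] to [v] along the first path, then back to [b] along the second; neither part meets
     [u]. *)
  apply: (@walk_avoiding_common_neighbor u _ _ (p ++ rev (belast b q))) => //.
  - by rewrite cat_path ep lp -lq rev_path (eq_path (e' := e)).
  - rewrite last_cat lp -lq; case: (q) => //= c r.
    by rewrite rev_cons last_rcons.
  rewrite -cat_cons mem_cat negb_or unp mem_rev.
  by apply: contra unq => /mem_belast.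
by rewrite -eq_ab in eq lq uq *; congr cons; apply: (IHp a).
Qed.

Lemma uv_path_geodesic u v p : uv_path e u v p -> geodesic e u v p.
Proof. by move=> pP; split=> // q /(uv_path_inj pP) ->. Qed.

(** The predecessor and the successor of [z] on the path are two distinct neighbours of [z]. *)
Lemma interior_not_leaf x y z p :
  uv_path e x y p -> z \in x :: p -> z != x -> z != y -> ~~ leaf e z.
Proof.
rewrite inE => -[ep lp up] /predU1P[-> /eqP//|z_p] _ neq_zy.
case/path.splitP: z_p ep lp up => p1 [|a p2].
  by rewrite cats0 last_rcons => _ def_z; rewrite def_z eqxx in neq_zy.
rewrite cat_path rcons_path last_rcons => /andP[/andP[_ ez] /andP[eza _]] _.
rewrite cat_rcons -cat_cons cat_uniq => /and3P[_ /hasPn/(_ a) new_a _].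
have neq_a : a != last x p1.
  apply: contraTneq (mem_last x p1) => <-; apply: new_a.
  by rewrite !inE eqxx orbT.
apply/negP=> /cards1P[w def_w].
have: a \in [set w] by rewrite -def_w inE.
have: last x p1 \in [set w] by rewrite -def_w inE sym_e.
by rewrite !inE => /eqP def_l /eqP def_a; rewrite def_l def_a eqxx in neq_a.
Qed.

(** A neighbour [w] of the last vertex lies on the path. The segment from [w] to the end and the
    single edge join the same vertices, so they coincide and [w] is the penultimate vertex. *)
Lemma maximal_path_leaf x p : irreflexive e -> p != [::] ->
  path e x p -> uniq (x :: p) ->
  (forall w, e (last x p) w -> w \in x :: p) ->
  leaf e (last x p).
Proof.
move=> irr_e; case/lastP: p => // p l _; rewrite last_rcons => ep up maxp.
have el : e (last x p) l by move: ep; rewrite rcons_path => /andP[].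
apply/cards1P; exists (last x p); apply/setP=> w; rewrite !inE.
apply/idP/eqP=> [elw | ->]; last by rewrite sym_e.
have w_p : w \in x :: rcons p l by apply: maxp.
case/splitPl def_p: {1}(rcons p l) / w_p => [p1 p2 lp1].
have [|_ wlP] := @uv_path_cat x l p1 p2.
  by rewrite -def_p; split; rewrite ?last_rcons.
have wl1P : uv_path e w l [:: l].
  split; rewrite /= ?[e w l]sym_e ?elw // inE andbT.
  by apply: contraTneq elw => ->; rewrite irr_e.
move: def_p; rewrite lp1 in wlP; rewrite (uv_path_inj wlP wl1P) cats1.
by move=> /rcons_inj[->].
Qed.

Lemma leaf_above x y : irreflexive e -> connected_graph e -> 1 < #|V| ->
  exists l, l \in leaves e :\ x /\ exists2 p, uv_path e x l p & y \in x :: p.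
Proof.
move=> irr_e conn_e V_gt1.
have [p [ep lp up]] := connect_uv_path (conn_e x y).
have [q [epq upq maxpq]] := extend_to_maximal_path ep up.
have y_pq : y \in x :: p ++ q by rewrite -cat_cons mem_cat -lp mem_last.
have pq_neq0 : p ++ q != [::].
  (* If the maximal path is trivial, [x] has no neighbour, and by connectedness it is the only
     vertex. *)
  apply: contraTneq V_gt1 => pq0; rewrite pq0 /= in maxpq.
  rewrite -leqNgt -(card1 x) subset_leq_card //; apply/subsetP=> z _.
  have /connectP[[|w r] /= er ->] := conn_e x z; first by rewrite inE.
  case/andP: er => exw _; have:= maxpq w exw; rewrite inE => /eqP def_w.
  by rewrite def_w irr_e in exw.
exists (last x (p ++ q)); split; last by exists (p ++ q).
rewrite !inE (maximal_path_leaf irr_e pq_neq0) // andbT.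
case: (p ++ q) pq_neq0 upq => //= a r _ /andP[+ _]; apply: contraNneq => <-.
exact: mem_last.
Qed.

(** Of two distinct vertices on [p], the earlier one lies on the prefix of [p] ending at the later
    one, and this prefix is a geodesic since paths are unique. *)
Lemma position_set_chain x l p S y z : position_set e x S -> uv_path e x l p ->
  y \in S -> z \in S -> y \in x :: p -> z \in x :: p -> y = z.
Proof.
move=> posS pP yS zS y_p z_p; apply/eqP/negP=> /negP neq_yz.
have prefix_free w w' q1 q2 : w \in S -> w' \in S -> w' != w ->
    p = q1 ++ q2 -> last x q1 = w -> w' \notin x :: q1.
  move=> wS w'S neq def_p lq1; apply: (posS w wS); first by rewrite !inE neq.
  rewrite -lq1; apply: uv_path_geodesic.
  by rewrite def_p in pP; case: (uv_path_cat pP).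
case/splitPl def_p: {1}p / y_p => [p1 p2 lp1].
move: z_p; rewrite def_p -cat_cons mem_cat => /orP[z_p1 | z_p2].
  have:= prefix_free y z p1 p2 yS zS; rewrite eq_sym z_p1.
  by move=> /(_ neq_yz def_p lp1).
case/path.splitP: z_p2 def_p => p3 p4; rewrite catA => def_p.
have:= prefix_free z y _ _ zS yS neq_yz def_p.
rewrite last_cat last_rcons -cat_cons mem_cat -lp1 mem_last.
by move=> /(_ erefl).
Qed.

Lemma position_set_leaves x : position_set e x (leaves e :\ x).
Proof.
move=> y _ z; rewrite !inE => /and3P[neq_zy neq_zx leaf_z] p [pP _].
by apply: contraL leaf_z => z_p; apply: interior_not_leaf pP _ _ _.
Qed.

End Paths.

Lemma card_position_set (V : finType) (e : rel V) (x : V) (S : {set V}) :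
  is_tree e -> 1 < #|V| -> position_set e x S -> #|S| <= #|leaves e :\ x|.
Proof.
move=> [[sym_e irr_e] conn_e acyc_e] V_gt1 posS.
have /choice[L LP] := fun y => leaf_above sym_e acyc_e x y irr_e conn_e V_gt1.
rewrite -(card_in_imset (f := L) (D := mem S)).
  by apply/subset_leq_card/subsetP=> _ /imsetP[y _ ->]; case: (LP y).
(* The paths from [x] to the common leaf coincide, so [y] and [z] lie on one path. *)
move=> y z yS zS eq_L; have [_ [p pP y_p]] := LP y; have [_ [q qP z_q]] := LP z.
rewrite -eq_L in qP; rewrite -(uv_path_inj sym_e acyc_e pP qP) in z_q.
exact: (position_set_chain sym_e acyc_e posS pP).
Qed.

(** The one-vertex tree is excluded: it has no leaf, yet [[set x]] is a position set, so its
    position number is 1. *)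
Theorem corollary3p6 (V : finType) (e : rel V) (x : V)
    (treeV : is_tree e) (nontrivialV : 1 < #|V|) :
  position_number e x = if leaf e x then #|leaves e| - 1 else #|leaves e|.
Proof.
have -> : (if leaf e x then #|leaves e| - 1 else #|leaves e|)
          = #|leaves e :\ x|.
  by rewrite (cardsD1 x (leaves e)) inE; case: (leaf e x); rewrite ?addKn.
apply/eqP; rewrite eqn_leq; apply/andP; split.
  by apply/bigmax_leqP=> S /asboolP; apply: card_position_set.
have [[sym_e _] _ acyc_e] := treeV.
(* The maximum is attained by the set of leaves other than [x]. *)
apply: (leq_bigmax_cond (F := fun S : {set V} => #|S|)).
by apply/asboolP/position_set_leaves.
Qed.
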